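(* Let $\mathscr{C}$ be the $m$-linear singular integral on $\mathbb{R}$ $$\mathscr{C}(\vec f)(x):=\int_{\mathbb{R}^m}K(x,\vec y)\prod_{j=1}^mf_j(y_j)\,d\vec y,\qquad K(x,\vec y):=\frac{(-1)^{(m-1)e(y_m-x)}}{(x-y_m)^m}\prod_{j=1}^{m-1}\mathbf{1}_{(x\wedge y_m,\,x\vee y_m)}(y_j).$$ Then $\mathscr{C}$ is a multilinear bounded oscillation operator with respect to the basis $\mathscr{B}$ of all intervals in $\mathbb{R}$ and the exponent $r=1$.
   Context: Here $e(x)=\mathbf{1}_{(0,\infty)}(x)$, $x\wedge y=\min\{x,y\}$, $x\vee y=\max\{x,y\}$. The operator generalizes the higher order Calder\'on commutators: for $a_j=A_j'$, $\mathscr{C}(a_1,\ldots,a_{m-1},f)(x)=\mathrm{p.v.}\int_{\mathbb{R}}\frac{\prod_{j=1}^{m-1}(A_j(x)-A_j(y))}{(x-y)^{m-1}}f(y)\frac{dy}{x-y}$, and the integral defining $\mathscr{C}$ is understood in this principal value sense; it is known that $\mathscr{C}$ is bounded from $L^1(\mathbb{R})\times\cdots\times L^1(\mathbb{R})$ to $L^{1/m,\infty}(\mathbb{R})$. $\mathbb{R}$ carries Lebesgue measure; for each (bounded, nondegenerate) interval $Q$ set $Q^*:=18Q$ (concentric dilate). Let $\langle f\rangle_Q:=\frac1{|Q|}\int_Q|f|$, $\lfloor f\rfloor_Q:=\sup_{Q'\in\mathscr{B},Q'\supset Q}\langle f\rangle_{Q'}$, $\vec f\mathbf{1}_E=(f_1\mathbf{1}_E,\ldots,f_m\mathbf{1}_E)$.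 A scalar-valued $m$-linear operator $T$ is a multilinear bounded oscillation operator with respect to $\mathscr{B}$ and $r=1$ if there are constants $\mathfrak{C}_1,\mathfrak{C}_2\in(0,\infty)$ such that: (T1) for every $Q_0\in\mathscr{B}$ there is $Q\in\mathscr{B}$, $Q\supsetneq Q_0$, such that for all $\vec f\in L^1(\mathbb{R})^m$, $\sup_{x\in Q_0}|T(\vec f\mathbf{1}_{Q^*})(x)-T(\vec f\mathbf{1}_{Q_0^*})(x)|\le\mathfrak{C}_1\prod_{i=1}^m\langle f_i\rangle_{Q^*}$; (T2) for every $Q\in\mathscr{B}$ and such $\vec f$, $\sup_{x,x'\in Q}|(T(\vec f)-T(\vec f\mathbf{1}_{Q^*}))(x)-(T(\vec f)-T(\vec f\mathbf{1}_{Q^*}))(x')|\le\mathfrak{C}_2\prod_{i=1}^m\lfloor f_i\rfloor_Q$. *)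

(* Defs.v *)
From HB Require Import structures.
From mathcomp Require Import all_boot all_order all_algebra.
From mathcomp Require Import complex.
From mathcomp Require Import all_classical all_reals all_analysis.

Set Implicit Arguments.
Unset Strict Implicit.
Unset Printing Implicit Defensive.

Import Order.TTheory GRing.Theory Num.Theory.
Import numFieldNormedType.Exports.

Local Open Scope classical_set_scope.
Local Open Scope ring_scope.
Local Open Scope complex_scope.

(* [n.-tuple T] carries the product sigma-algebra; the n-fold product measure is
   built by adding one coordinate at a time. *)
Section tuple_measure.
Context d (T : measurableType d) (R : realType).
Variable mu : {sigma_finite_measure set T -> \bar R}.

Definition tuple_cons n (p : T * n.-tuple T) : n.+1.-tuple T :=
  [tuple of p.1 :: p.2].

Lemma measurable_tuple_cons n :
  measurable_fun [set: T * n.-tuple T] (@tuple_cons n).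
Proof. exact: (@measurable_cons _ _ (T * n.-tuple T)%type T fst n snd). Qed.

Section cons_measure.
Variables (n : nat) (nu : {sigma_finite_measure set (n.-tuple T) -> \bar R}).

Definition cons_measure : set (n.+1.-tuple T) -> \bar R :=
  pushforward (mu \x nu)%E (@tuple_cons n).

Let cons_measure0 : cons_measure set0 = 0%E.
Proof. by rewrite /cons_measure /pushforward preimage_set0 measure0. Qed.

Let cons_measure_ge0 A : (0 <= cons_measure A)%E.
Proof. by rewrite /cons_measure /pushforward measure_ge0. Qed.

Let cons_measure_sigma_additive : semi_sigma_additive cons_measure.
Proof.
have mc A : measurable A -> measurable (@tuple_cons n @^-1` A).
  by move=> mA; rewrite -[X in measurable X]setTI; exact: measurable_tuple_cons.
move=> F mF tF mUF; rewrite /cons_measure /pushforward preimage_bigcup.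
apply: measure_semi_sigma_additive.
- by move=> k; exact: mc.
- apply/trivIsetP => i j _ _ ij; rewrite -preimage_setI.
  by move/trivIsetP : tF => /(_ _ _ I I ij) ->; rewrite preimage_set0.
- by rewrite -preimage_bigcup; exact: mc.
Qed.

HB.instance Definition _ := isMeasure.Build _ _ _ cons_measure
  cons_measure0 cons_measure_ge0 cons_measure_sigma_additive.

Let cons_measure_sigma_finite : sigma_finite setT cons_measure.
Proof.
have /sigma_finiteP[F [TF ndF Foo]] := sigma_finiteT mu.
have /sigma_finiteP[G [TG ndG Goo]] := sigma_finiteT nu.
pose u (t : n.+1.-tuple T) : T * n.-tuple T :=
  (tnth t ord0, [tuple of behead t]).
have mu_ : measurable_fun setT u.
  by apply/measurable_fun_pairP; split;
    [exact: measurable_tnth|exact: measurable_behead].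
have uK p : u (tuple_cons p) = p.
  by case: p => x t; rewrite /u; congr pair; exact/val_inj.
exists (fun k => u @^-1` (F k `*` G k)).
  apply/esym; rewrite -subTset => t _.
  have [i _ Fi] : (\bigcup_k F k) (u t).1 by rewrite -TF.
  have [j _ Gj] : (\bigcup_k G k) (u t).2 by rewrite -TG.
  exists (maxn i j) => //; split.
  - by move: Fi; exact/subsetPset/ndF/leq_maxl.
  - by move: Gj; exact/subsetPset/ndG/leq_maxr.
move=> k; have [mF Fk] := Foo k; have [mG Gk] := Goo k; split.
  by rewrite -[X in measurable X]setTI; apply: mu_ => //; exact: measurableX.
rewrite /cons_measure /pushforward (_ : _ @^-1` _ = F k `*` G k).
  by rewrite product_measure1E// lte_mul_pinfty// ge0_fin_numE.
by rewrite -comp_preimage (_ : u \o _ = id)//; exact/funext.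
Qed.

HB.instance Definition _ := Measure_isSigmaFinite.Build _ _ _
  cons_measure cons_measure_sigma_finite.
End cons_measure.

Fixpoint tuple_measure n : {sigma_finite_measure set (n.-tuple T) -> \bar R} :=
  if n is k.+1 then cons_measure (tuple_measure k)
  else dirac ([tuple] : 0.-tuple T).

End tuple_measure.

Section multilinear_bounded_oscillation.
Variable R : realType.
Local Notation Rm := (measurableTypeR R).
Local Notation mu := (@lebesgue_measure R).
Local Notation Re := (@complex.Re R).
Local Notation Im := (@complex.Im R).
Local Notation normc := (@ComplexField.Normc.normc R).

Definition cintegrable (f : Rm -> R[i]) : Prop :=
  mu.-integrable setT (fun y => (Re (f y))%:E) /\
  mu.-integrable setT (fun y => (Im (f y))%:E).

Definition cintegral d (T : measurableType d) (nu : {measure set T -> \bar R})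
    (D : set T) (F : T -> R[i]) : R[i] :=
  (\int[nu]_(y in D) Re (F y)) +i* (\int[nu]_(y in D) Im (F y)).

Definition intervals : set (set R) :=
  [set Q | exists (a b : R) (s t : bool),
    a < b /\ Q = [set` Interval (BSide s a) (BSide t b)]].

Definition dilation (lambda : R) (Q : set R) : set R :=
  let c := (inf Q + sup Q) / 2 in [set c + lambda * (y - c) | y in Q].

Definition star (Q : set R) : set R := dilation 18 Q.

Definition average (f : R -> R[i]) (Q : set R) : R :=
  (fine (mu Q))^-1 * \int[mu]_(y in Q) normc (f y).

Definition sup_average (B : set (set R)) (f : R -> R[i]) (Q : set R) : R :=
  sup [set average f Q' | Q' in [set Q' | B Q' /\ Q `<=` Q']].

Definition restrictm m (E : set R) (f : 'I_m -> R -> R[i]) : 'I_m -> R -> R[i] :=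
  fun i y => (\1_E y)%:C * f i y.

Definition substm m (f : 'I_m -> R -> R[i]) (i : 'I_m) (g : R -> R[i]) :
    'I_m -> R -> R[i] :=
  fun k => if k == i then g else f k.

(* A principal value integral of integrable functions exists only almost
   everywhere, so [T f] is a partial function: [mop_dom T f] is the set of points
   at which it is defined, and its values elsewhere are irrelevant. *)
Record moperator m := MOperator {
  mop_dom : ('I_m -> R -> R[i]) -> set R;
  mop_val :> ('I_m -> R -> R[i]) -> R -> R[i] }.

Definition multilinear m (T : moperator m) : Prop :=
  forall (f : 'I_m -> R -> R[i]) (i : 'I_m) (g h : R -> R[i]) (c : R[i]) (x : R),
    (forall k, cintegrable (f k)) -> cintegrable g -> cintegrable h ->
    mop_dom T (substm f i g) x -> mop_dom T (substm f i h) x ->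
    let gh := substm f i (fun y => g y + c * h y) in
    mop_dom T gh x /\
    T gh x = T (substm f i g) x + c * T (substm f i h) x.

(* The suprema over points of a set are suprema over the points of this set at
   which the functions involved are defined. *)
Definition bounded_oscillation_T1 m (B : set (set R)) (T : moperator m)
    (C1 : R) : Prop :=
  forall Q0, B Q0 -> exists Q, [/\ B Q, Q0 `<` Q &
    forall f : 'I_m -> R -> R[i], (forall i, cintegrable (f i)) ->
    forall x, Q0 x ->
      mop_dom T (restrictm (star Q) f) x ->
      mop_dom T (restrictm (star Q0) f) x ->
      normc (T (restrictm (star Q) f) x - T (restrictm (star Q0) f) x)
        <= C1 * \prod_i average (f i) (star Q)].

Definition bounded_oscillation_T2 m (B : set (set R)) (T : moperator m)
    (C2 : R) : Prop :=
  forall Q, B Q ->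
    forall f : 'I_m -> R -> R[i], (forall i, cintegrable (f i)) ->
    forall x x', Q x -> Q x' ->
      mop_dom T f x -> mop_dom T (restrictm (star Q) f) x ->
      mop_dom T f x' -> mop_dom T (restrictm (star Q) f) x' ->
      normc ((T f x - T (restrictm (star Q) f) x) -
             (T f x' - T (restrictm (star Q) f) x'))
        <= C2 * \prod_i sup_average B (f i) Q.

Definition bounded_oscillation m (B : set (set R)) (T : moperator m) : Prop :=
  multilinear T /\
  exists C1 C2 : R, [/\ 0 < C1, 0 < C2,
    bounded_oscillation_T1 B T C1 & bounded_oscillation_T2 B T C2].

(* These are for [m.+1] functions, so that there is a last variable
   [tnth y ord_max], the y_m of the kernel (which is singular at y_m = x). *)
Definition calderon_kernel m (x : R) (y : m.+1.-tuple R) : R :=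
  let ym := tnth y ord_max in
  (-1) ^+ (m * (0 < ym - x)%R) / (x - ym) ^+ m.+1 *
  \prod_(j < m.+1 | j != ord_max)
    \1_`]Num.min x ym, Num.max x ym[%classic (tnth y j).

Definition calderon_trunc m (f : 'I_m.+1 -> R -> R[i]) (x e : R) : R[i] :=
  cintegral (tuple_measure mu m.+1) [set y | e < `|x - tnth y ord_max|]
    (fun y => (calderon_kernel x y)%:C * \prod_(j < m.+1) f j (tnth y j)).

(* Limits in R[i] are taken on real and imaginary parts separately. *)
Definition calderon m : moperator m.+1 := {|
  mop_dom f := [set x |
    cvg (Re (calderon_trunc f x e) @[e --> 0^'+]) /\
    cvg (Im (calderon_trunc f x e) @[e --> 0^'+])];
  mop_val f x :=
    lim (Re (calderon_trunc f x e) @[e --> 0^'+]) +i*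
    lim (Im (calderon_trunc f x e) @[e --> 0^'+]) |}.

End multilinear_bounded_oscillation.

Arguments intervals R : clear implicits.

(* Main.v *)
Require Import Defs.
From mathcomp Require Import all_boot all_order all_algebra.
From mathcomp Require Import complex ring lra.
From mathcomp Require Import all_classical all_reals all_analysis.
From mathcomp Require Import measurable_realfun.

Set Implicit Arguments.
Unset Strict Implicit.
Unset Printing Implicit Defensive.

Import Order.TTheory GRing.Theory Num.Theory.
Import numFieldNormedType.Exports.

Local Open Scope classical_set_scope.
Local Open Scope ring_scope.
Local Open Scope complex_scope.

(**
Write K for the kernel with m+1 variables y_j and w for the last of them.  Since
the sign in K only corrects the sign of (x - w)^(m+1), one has

  K(x, y) = sgn(x - w) |x - w|^-(m+1)  if every other y_j lies strictly
            between x and w,   and   K(x, y) = 0  otherwise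

([calderon_kernelE]).
Everything rests on the localization built into this support: if x and w lie
in an interval E, then so do all the y_j, so cutting every f_j to E does not
change the integrand.  Hence for x in Q the integrand of
C(f) - C(f 1_{18 Q}) lives on w outside 18 Q, at a distance from x comparable with
the length of Q or larger.  There K is bounded, the principal value no longer
matters, and for all small e the e-truncations of the difference coincide.
So it suffices to bound absolutely convergent integrals of a real kernel k
against the product of the f_j, uniformly in small e, and to pass to the limit.
The real and the imaginary part are bounded separately, which costs a factor 2.

Such an integral is bounded by pointwise domination of |k| by constants times
indicators of boxes A_1 x ... x A_(m+1), because the integral of the product of
the |f_j| over a box factorizes ([integral_tuple_prod], by Tonelli's theorem):
[pairing_le_box] uses one box and [pairing_le_boxes] a series of boxes.

For (T1), let r be the radius of Q_0 and take Q = 2 Q_0.  The difference of the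
two kernels is carried by w outside 18 Q_0, where |x - w| >= 9 r, and is at
most (9 r)^-(m+1) on the cube of 18 Q ([trunc_kernel_ring]).  As 18 Q has
length 72 r, this gives 8^(m+1) times the product of the averages.

For (T2) let x, x' be in Q, with centre c and radius r, and split the
complement of 18 Q into the dyadic shells 2 L <= |w - c| < 4 L with
L = 8 2^l r ([radius_shell]).  On such a shell two things can happen
([calderon_kernel_diff]).  If the support conditions for x and for x' both
hold, the two values of K have the same sign and differ by at most
(m+1) |x - x'| L^-(m+2), and all the y_j are in the ball of radius 4 L.
If only one of them holds, some y_j other than w lies between x and x', hence
in Q, and the difference is at most L^-(m+1).  In both cases the integral
over the box gains the factor r / L over the product of the suprema of averages:
from the smoothness of the power, or from the short side Q.  These
gains form a geometric series in l.

Multilinearity passes to the limit from the truncated integrals, whose kernels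
are bounded.
*)

(** * Integration of tensor products over tuples *)

Section tuple_integral.
Context d (T : measurableType d) (R : realType).
Variable mu : {sigma_finite_measure set T -> \bar R}.

Lemma measurable_prod_tnth n (g : 'I_n -> T -> R) :
  (forall i, measurable_fun setT (g i)) ->
  measurable_fun setT (fun y : n.-tuple T => \prod_(i < n) g i (tnth y i)).
Proof.
move=> mg; apply: measurable_prod => i _.
by apply: (measurableT_comp (mg i)); exact: measurable_tnth.
Qed.

(** Adding one coordinate is a pushforward of a product measure, so Tonelli's
    theorem peels off the first factor. *)
Lemma integral_tuple_prod n (g : 'I_n -> T -> R) :
  (forall i, mu.-integrable setT (EFin \o g i)) ->
  (forall i x, 0 <= g i x) ->
  (\int[tuple_measure mu n]_y (\prod_(i < n) g i (tnth y i))%:E =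
   (\prod_(i < n) \int[mu]_x g i x)%:E)%E.
Proof.
elim: n g => [|n IH] g ig g0.
  rewrite integral_dirac//; last first.
    by apply/measurable_EFinP; apply: measurable_prod_tnth => -[].
  by rewrite diracE in_setT mul1e !big_ord0.
have mg i : measurable_fun setT (g i).
  by apply/measurable_EFinP; exact: measurable_int (ig i).
pose h (i : 'I_n) := g (lift ord0 i).
have hE (x : T) (t : n.-tuple T) :
    \prod_(i < n.+1) g i (tnth (tuple_cons (x, t)) i) =
    g ord0 x * \prod_(i < n) h i (tnth t i).
  rewrite big_ord_recl; congr (_ * _).
  by apply: eq_bigr => i _; rewrite tnthS.
have mh : measurable_fun setT (fun t : n.-tuple T => \prod_(i < n) h i (tnth t i)).
  by apply: measurable_prod_tnth => i; exact: mg.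
have h0 t : 0 <= \prod_(i < n) h i (tnth t i).
  by apply: prodr_ge0 => i _; exact: g0.
rewrite /= ge0_integral_pushforward//; first last.
- by move=> y _; rewrite lee_fin prodr_ge0.
- by apply/measurable_EFinP; exact: (measurable_prod_tnth mg).
- exact: measurable_tuple_cons.
rewrite preimage_setT fubini_tonelli1//=; first last.
- by move=> [x t] /=; rewrite lee_fin prodr_ge0.
- apply/measurable_EFinP.
  exact: (measurableT_comp (measurable_prod_tnth mg) (@measurable_tuple_cons _ _ n)).
rewrite /fubini_F /=.
under eq_integral.
  move=> x _; under eq_integral.
    by move=> t _; rewrite hE EFinM; over.
  rewrite ge0_integralZl_EFin//; first last.
  - exact/measurable_EFinP.
  - by move=> t _; rewrite lee_fin.
  rewrite (IH h (fun=> ig _) (fun=> g0 _)).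
  rewrite -EFinM mulrC EFinM.
  over.
rewrite /= ge0_integralZl_EFin//; first last.
- by apply: prodr_ge0 => i _; apply: Rintegral_ge0 => x _; exact: g0.
- exact/measurable_EFinP.
- by move=> x _; rewrite lee_fin; exact: g0.
rewrite big_ord_recl mulrC EFinM; congr (_ * _)%E.
by rewrite /Rintegral fineK//; exact: (integrable_fin_num measurableT (ig ord0)).
Qed.

End tuple_integral.

(** * Pairing a real kernel with a tensor product of complex functions *)

Section coordinates.
Variable R : realType.
Local Notation normc := (@ComplexField.Normc.normc R).
Implicit Types (z w : R[i]) (b : bool).

(** The real part for [true] and the imaginary part for [false]: every estimate
    and every limit is treated once for both. *)
Definition coord b z : R := if b then complex.Re z else complex.Im z.

Lemma coordB b z w : coord b (z - w) = coord b z - coord b w.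
Proof. by case: b z w => -[x y] [x' y']. Qed.

Lemma coord_realM b (k : R) z : coord b (k%:C * z) = k * coord b z.
Proof. by case: b z => -[x y] /=; rewrite mul0r ?subr0 ?addr0. Qed.

Lemma coord_le_normc b z : `|coord b z| <= normc z.
Proof.
by case: b z => -[x y] /=; rewrite -sqrtr_sqr ler_sqrt ?addr_ge0 ?sqr_ge0//
   ?lerDl ?lerDr sqr_ge0.
Qed.

Lemma normc_le_coord z : normc z <= `|coord true z| + `|coord false z|.
Proof.
case: z => x y /=; rewrite -[leRHS]ger0_norm ?addr_ge0// -sqrtr_sqr.
rewrite ler_sqrt ?sqr_ge0// sqrrD !real_normK ?num_real// -addrA lerD2l.
by rewrite lerDr mulrn_wge0// mulr_ge0.
Qed.

Lemma normc_ge0 z : 0 <= normc z.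
Proof. exact: le_trans (normr_ge0 _) (coord_le_normc true z). Qed.

Lemma normc_prod (I : Type) (r : seq I) (F : I -> R[i]) :
  normc (\prod_(i <- r) F i) = \prod_(i <- r) normc (F i).
Proof.
exact: (big_morph _ (@ComplexField.Normc.normcM R) (ComplexField.Normc.normc1 R)).
Qed.

Lemma real_complex_prod (I : Type) (r : seq I) (F : I -> R) :
  \prod_(i <- r) (F i)%:C = (\prod_(i <- r) F i)%:C.
Proof. by rewrite (rmorph_prod (real_complex R)). Qed.

Lemma measurable_coord_prod d (T : measurableType d) (I : eqType) (r : seq I)
    (F : I -> T -> R[i]) :
  (forall i b, measurable_fun setT (coord b \o F i)) ->
  forall b, measurable_fun setT (coord b \o (fun y => \prod_(i <- r) F i y)).
Proof.
move=> mF; elim: r => [|i r IH] b.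
  rewrite (_ : _ \o _ = cst (coord b 1)); first exact: measurable_cst.
  by apply/funext => y /=; rewrite big_nil.
pose P y := \prod_(i <- r) F i y.
have -> : coord b \o (fun y => \prod_(i <- i :: r) F i y) =
    if b then (coord true \o F i) \* (coord true \o P) \-
              (coord false \o F i) \* (coord false \o P)
    else (coord true \o F i) \* (coord false \o P) \+
         (coord false \o F i) \* (coord true \o P).
  apply/funext => y; rewrite /= big_cons -/(P y).
  by case: b; rewrite /=; case: (F i y) (P y) => ? ? [].
by case: b; [apply: measurable_funB|apply: measurable_funD];
  apply: measurable_funM.
Qed.

End coordinates.

Section pairing.
Variables (R : realType) (n : nat).
Local Notation Rm := (measurableTypeR R).
Local Notation mu := (@lebesgue_measure R).
Local Notation normc := (@ComplexField.Normc.normc R).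
Local Notation Rn := (n.-tuple Rm).
Local Notation mun := (tuple_measure mu n).
Implicit Types (f : 'I_n -> R -> R[i]) (k : Rn -> R).

Definition tensor f (y : n.-tuple R) : R[i] := \prod_(j < n) f j (tnth y j).

Definition pairing b f k : R := \int[mun]_y (k y * coord b (tensor f y)).

(** Enough for [pairing] to converge absolutely against integrable functions,
    hence to be linear in the kernel. *)
Definition bounded_kernel k :=
  measurable_fun setT k /\ exists M, forall y, `|k y| <= M.

Lemma measurable_coord (g : R -> R[i]) b :
  cintegrable g -> measurable_fun setT (coord b \o g : Rm -> R).
Proof.
by move=> [g1 g2]; apply/measurable_EFinP; case: b;
  [exact: measurable_int g1|exact: measurable_int g2].
Qed.

Lemma integrable_normc (g : R -> R[i]) :
  cintegrable g -> mu.-integrable setT (EFin \o (normc \o g)).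
Proof.
move=> ig; have [ig1 ig2] := ig.
have ia : mu.-integrable setT (fun x : Rm =>
    (`|coord true (g x)| + `|coord false (g x)|)%:E).
  have := integrableD measurableT (integrable_abse ig1) (integrable_abse ig2).
  by apply: eq_integrable.
apply: le_integrable ia => //.
- apply/measurable_EFinP.
  rewrite (_ : _ \o _ = (fun x : R => Num.sqrt x) \o
    ((fun x : Rm => coord true (g x) ^+ 2) \+ (fun x => coord false (g x) ^+ 2))).
    apply: measurableT_comp.
      by apply: continuous_measurable_fun; exact: sqrt_continuous.
    by apply: measurable_funD; apply: measurable_funX; exact: measurable_coord.
  by apply/funext => x /=; case: (g x).
- move=> x _ /=; rewrite lee_fin [leLHS]ger0_norm ?normc_ge0//.
  rewrite [leRHS]ger0_norm ?addr_ge0//.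
  exact: normc_le_coord.
Qed.

Lemma measurable_normc (g : R -> R[i]) :
  cintegrable g -> measurable_fun setT (normc \o g : Rm -> R).
Proof. by move=> /integrable_normc /measurable_int /measurable_EFinP. Qed.

Lemma measurable_coord_tensor f b : (forall i, cintegrable (f i)) ->
  measurable_fun setT (coord b \o tensor f : Rn -> R).
Proof.
move=> If.
pose F (j : 'I_n) (y : Rn) := f j (tnth y j).
apply: (@measurable_coord_prod R _ _ _ (index_enum 'I_n) F) => j b'.
apply: (measurableT_comp (measurable_coord b' (If j))).
exact: measurable_tnth.
Qed.

Lemma normc_tensor f y : normc (tensor f y) = \prod_(j < n) normc (f j (tnth y j)).
Proof. exact: normc_prod. Qed.

Lemma integral_normc_tensor f : (forall i, cintegrable (f i)) ->
  (\int[mun]_y (normc (tensor f y))%:E =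
   (\prod_(i < n) \int[mu]_x normc (f i x))%:E)%E.
Proof.
move=> If; under eq_integral do rewrite normc_tensor.
apply: (@integral_tuple_prod _ _ _ mu n (fun i => normc \o f i)) => i.
  exact: integrable_normc.
by move=> x; exact: normc_ge0.
Qed.

Lemma measurable_normc_tensor f : (forall i, cintegrable (f i)) ->
  measurable_fun setT (normc \o tensor f : Rn -> R).
Proof.
move=> If; rewrite (_ : _ \o _ = fun y => \prod_(j < n) (normc \o f j) (tnth y j)).
  by apply: (measurable_prod_tnth (g := fun j => normc \o f j)) => j;
    exact: measurable_normc.
by apply/funext => y /=; rewrite normc_tensor.
Qed.

Lemma integrable_pairing b f k :
  (forall i, cintegrable (f i)) -> bounded_kernel k ->
  mun.-integrable setT (fun y => (k y * coord b (tensor f y))%:E).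
Proof.
move=> If [mk [M kM]].
have iN : mun.-integrable setT (fun y => (normc (tensor f y))%:E).
  apply/integrableP; split.
    by apply/measurable_EFinP; exact: measurable_normc_tensor.
  under eq_integral do rewrite /= (ger0_norm (normc_ge0 _)).
  by rewrite integral_normc_tensor// ltry.
apply: le_integrable (integrableZl measurableT M iN) => //.
- apply/measurable_EFinP/measurable_funM => //.
  exact: measurable_coord_tensor.
- move=> y _ /=; rewrite lee_fin normrM normrM (ger0_norm (normc_ge0 _)).
  apply: ler_pM => //; last exact: coord_le_normc.
  exact: le_trans (kM y) (ler_norm _).
Qed.

Lemma pairingB b f k1 k2 : (forall i, cintegrable (f i)) ->
  bounded_kernel k1 -> bounded_kernel k2 ->
  pairing b f k1 - pairing b f k2 = pairing b f (k1 \- k2).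
Proof.
move=> If b1 b2; rewrite /pairing -RintegralB//; try exact: integrable_pairing.
by apply: eq_Rintegral => y _; rewrite mulrBl.
Qed.

Lemma pairing_le b f k : (forall i, cintegrable (f i)) -> bounded_kernel k ->
  (`|pairing b f k|%:E <= \int[mun]_y (`|k y| * normc (tensor f y))%:E)%E.
Proof.
move=> If bk; have [mk _] := bk.
rewrite EFin_normr_Rintegral//; last exact: integrable_pairing.
apply: le_trans (le_abse_integral _ _ _) _ => //.
  by have /measurable_int := integrable_pairing b If bk.
apply: ge0_le_integral => //.
- apply: measurableT_comp => //.
  by have /measurable_int := integrable_pairing b If bk.
- apply/measurable_EFinP/measurable_funM; first exact: measurableT_comp.
  exact: measurable_normc_tensor.
- by move=> y _ /=; rewrite lee_fin normrM ler_wpM2l// coord_le_normc.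
Qed.

End pairing.

(** * Domination by boxes *)

Lemma prod_indicE (R : realType) (I : finType) (P : pred I) (A : I -> set R)
    (z : I -> R) :
  \prod_(i | P i) \1_(A i) (z i) = [forall i, P i ==> (z i \in A i)]%:R :> R.
Proof.
have [/forallP h|] := boolP [forall i, P i ==> (z i \in A i)].
  by rewrite big1// => i Pi; rewrite indicE (implyP (h i) Pi).
move=> /forallPn[j]; rewrite negb_imply => /andP[Pj zj].
by rewrite (bigD1 j)//= indicE (negbTE zj) mul0r.
Qed.

Section boxes.
Variables (R : realType) (n : nat).
Local Notation Rm := (measurableTypeR R).
Local Notation mu := (@lebesgue_measure R).
Local Notation normc := (@ComplexField.Normc.normc R).
Local Notation Rn := (n.-tuple Rm).
Local Notation mun := (tuple_measure mu n).
Implicit Types (f : 'I_n -> R -> R[i]) (k : Rn -> R) (A : 'I_n -> set R).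

Definition box A (y : n.-tuple R) : R := \prod_(i < n) \1_(A i) (tnth y i).

Lemma box_ge0 A y : 0 <= box A y.
Proof. by apply: prodr_ge0 => i _; rewrite indicE. Qed.

Lemma boxE A y : box A y = [forall i, tnth y i \in A i]%:R.
Proof.
by rewrite /box prod_indicE.
Qed.

Lemma measurable_box A : (forall i, measurable (A i : set Rm)) ->
  measurable_fun setT (box A : Rn -> R).
Proof.
move=> mA; apply: (measurable_prod_tnth (T := Rm) (g := fun i => \1_(A i))) => i.
exact: measurable_indic.
Qed.

Lemma integral_box A f :
  (forall i, measurable (A i : set Rm)) -> (forall i, cintegrable (f i)) ->
  (\int[mun]_y (box A y * normc (tensor f y))%:E =
   (\prod_(i < n) \int[mu]_(x in A i) normc (f i x))%:E)%E.
Proof.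
move=> mA If; under eq_integral do rewrite normc_tensor -big_split.
pose g i := (\1_(A i) : R -> R) \* (normc \o f i).
rewrite (@integral_tuple_prod _ _ _ mu n g).
- congr (_%:E); apply: eq_bigr => i _; rewrite [RHS]Rintegral_mkcond.
  apply: eq_Rintegral => x _; rewrite /g /= patchE indicE.
  by case: ifPn => _; rewrite ?mul1r ?mul0r.
- move=> i; apply: le_integrable (integrable_normc (If i)) => //.
    apply/measurable_EFinP/measurable_funM; first exact: measurable_indic.
    exact: measurable_normc.
  move=> x _ /=; rewrite lee_fin normrM ler_piMl// ger0_norm ?indicE//.
  by case: (_ \in _).
- by move=> i x; rewrite mulr_ge0 ?normc_ge0// indicE.
Qed.

Lemma pairing_le_box b f k A (c : R) :
  (forall i, measurable (A i : set Rm)) -> (forall i, cintegrable (f i)) ->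
  bounded_kernel k -> 0 <= c -> (forall y, `|k y| <= c * box A y) ->
  `|pairing b f k| <= c * \prod_(i < n) \int[mu]_(x in A i) normc (f i x).
Proof.
move=> mA If bk c0 kA; rewrite -lee_fin EFinM -integral_box//.
apply: le_trans (pairing_le b If bk) _.
have mb : measurable_fun setT (fun y : Rn => box A y * normc (tensor f y)).
  apply: measurable_funM; first exact: measurable_box.
  exact: measurable_normc_tensor.
rewrite -ge0_integralZl_EFin//; first last.
- exact/measurable_EFinP.
- by move=> y _; rewrite lee_fin mulr_ge0 ?box_ge0 ?normc_ge0.
apply: ge0_le_integral => //.
- by move=> y _; rewrite lee_fin mulr_ge0 ?normc_ge0.
- apply/measurable_EFinP/measurable_funM; last exact: measurable_normc_tensor.
  by apply: measurableT_comp => //; case: bk.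
- by apply/measurable_EFinP/measurable_funM.
- by move=> y _; rewrite -EFinM lee_fin mulrA ler_wpM2r ?normc_ge0.
Qed.

(** Only one term [l] of the series has to dominate at a given point; the weights
    [2 ^- l.+1] sum up to 1. *)
Lemma pairing_le_boxes b f k (J : finType) (A : nat -> J -> 'I_n -> set R)
    (c : nat -> J -> R) (M : R) :
  (forall l j i, measurable (A l j i : set Rm)) ->
  (forall i, cintegrable (f i)) -> bounded_kernel k ->
  (forall l j, 0 <= c l j) ->
  (forall y, k y != 0 ->
    exists l, `|k y| <= \sum_(j : J) c l j * box (A l j) y) ->
  (forall l, \sum_(j : J)
      c l j * \prod_(i < n) \int[mu]_(x in A l j i) normc (f i x)
    <= M / (2 ^ l.+1)%:R) ->
  `|pairing b f k| <= M.
Proof.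
move=> mA If bk c0 kA cM.
pose G l (y : Rn) := \sum_(j : J) c l j * box (A l j) y.
have G0 l y : 0 <= G l y by apply: sumr_ge0 => j _; rewrite mulr_ge0 ?box_ge0.
have mbox l j : measurable_fun setT (fun y : Rn => box (A l j) y * normc (tensor f y)).
  apply: measurable_funM; first exact: measurable_box.
  exact: measurable_normc_tensor.
have mG l : measurable_fun setT (fun y : Rn => G l y * normc (tensor f y)).
  apply: measurable_funM; last exact: measurable_normc_tensor.
  apply: measurable_sum => j; apply: measurable_funM => //.
  exact: measurable_box.
have intG l : (\int[mun]_y (G l y * normc (tensor f y))%:E =
    (\sum_(j : J) c l j * \prod_(i < n) \int[mu]_(x in A l j i) normc (f i x))%:E)%E.
  under eq_integral do rewrite /G mulr_suml -sumEFin.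
  rewrite ge0_integral_sum//; first last.
  - by move=> j y _; rewrite lee_fin !mulr_ge0 ?box_ge0 ?normc_ge0.
  - move=> j; apply/measurable_EFinP.
    under eq_fun do rewrite -mulrA.
    exact: measurable_funM.
  rewrite -sumEFin; apply: eq_bigr => j _.
  under eq_integral do rewrite -mulrA EFinM.
  rewrite ge0_integralZl_EFin//; first last.
  - exact/measurable_EFinP.
  - by move=> y _; rewrite lee_fin mulr_ge0 ?box_ge0 ?normc_ge0.
  by rewrite integral_box// EFinM.
rewrite -lee_fin; apply: le_trans (pairing_le b If bk) _.
have geo : (\sum_(l <oo) (M / (2 ^ l.+1)%:R)%:E = M%:E)%E.
  apply/cvg_lim => //; have := @cvg_geometric_eseries_half _ M 0.
  by rewrite expr0 divr1 /eseries; under eq_fun do under eq_bigr do rewrite addn1.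
rewrite -geo.
apply: (@le_trans _ _ (\sum_(l <oo) (\int[mun]_y (G l y * normc (tensor f y))%:E))%E);
  last first.
  apply: lee_nneseries => [l _ _|l _].
    by apply: integral_ge0 => y _; rewrite lee_fin mulr_ge0 ?normc_ge0.
  by rewrite intG lee_fin.
rewrite -integral_nneseries//; first last.
- by move=> l y _; rewrite lee_fin mulr_ge0 ?normc_ge0.
- by move=> l; exact/measurable_EFinP.
apply: ge0_le_integral => //.
- by move=> y _; rewrite lee_fin mulr_ge0 ?normc_ge0.
- apply/measurable_EFinP/measurable_funM; last exact: measurable_normc_tensor.
  by apply: measurableT_comp => //; case: bk.
- apply: ge0_emeasurable_sum => //.
  + by move=> l y _ _; rewrite lee_fin mulr_ge0 ?normc_ge0.
  + by move=> l _; exact/measurable_EFinP.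
- move=> y _; have [->|ky] := eqVneq (k y) 0.
    rewrite normr0 mul0r; apply: nneseries_ge0 => l _ _.
    by rewrite lee_fin mulr_ge0 ?normc_ge0.
  have [l kl] := kA y ky.
  apply: (@le_trans _ _ (G l y * normc (tensor f y))%:E).
    by rewrite lee_fin ler_wpM2r ?normc_ge0.
  rewrite (nneseriesD1 (n := l))//; last first.
    by move=> i _; rewrite lee_fin mulr_ge0 ?normc_ge0.
  rewrite leeDl//; apply: nneseries_ge0 => i _ _.
  by rewrite lee_fin mulr_ge0 ?normc_ge0.
Qed.

End boxes.

(** * The Calderon commutator kernel *)

Lemma measurable_natr_bool (R : realType) d (T : measurableType d) (p : T -> bool) :
  measurable_fun setT p -> measurable_fun setT (fun t => (p t)%:R : R).
Proof.
move=> mp; rewrite (_ : (fun _ => _) = fun t => if p t then 1 else 0 : R).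
  exact: measurable_fun_ifT.
by apply/funext => t; case: (p t).
Qed.

Section kernel.
Variables (R : realType) (m : nat).
Local Notation Rm := (measurableTypeR R).
Local Notation mu := (@lebesgue_measure R).
Local Notation Rn := (m.+1.-tuple Rm).
Local Notation mun := (tuple_measure mu m.+1).
Implicit Types (f : 'I_m.+1 -> R -> R[i]) (x e : R) (y : m.+1.-tuple R).

Lemma bounded_kernelM (k1 k2 : Rn -> R) :
  bounded_kernel k1 -> bounded_kernel k2 -> bounded_kernel (k1 \* k2).
Proof.
move=> [mk1 [M1 kM1]] [mk2 [M2 kM2]]; split; first exact: measurable_funM.
by exists (M1 * M2) => y; rewrite normrM ler_pM.
Qed.

Lemma bounded_kernelB (k1 k2 : Rn -> R) :
  bounded_kernel k1 -> bounded_kernel k2 -> bounded_kernel (k1 \- k2).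
Proof.
move=> [mk1 [M1 kM1]] [mk2 [M2 kM2]]; split; first exact: measurable_funB.
exists (M1 + M2) => y; apply: le_trans (ler_normB _ _) _.
exact: lerD.
Qed.

Lemma bounded_kernel_box (A : 'I_m.+1 -> set R) :
  (forall i, measurable (A i : set Rm)) -> bounded_kernel (box A : Rn -> R).
Proof.
move=> mA; split; first exact: measurable_box.
by exists 1 => y; rewrite boxE; case: [forall _, _]; rewrite ?normr1 ?normr0.
Qed.

Definition between x y : bool :=
  [forall j : 'I_m.+1, (j != ord_max) ==>
    (Num.min x (tnth y ord_max) < tnth y j < Num.max x (tnth y ord_max))].

(** The factor [(-1) ^+ m] on the right of [x] combines with the sign of
    [(x - y_m) ^+ m.+1] into the single sign of [x - y_m]. *)
Lemma calderon_kernelE x y :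
  calderon_kernel x y = (-1) ^+ (0 < tnth y ord_max - x)%R *
    (`|x - tnth y ord_max| ^+ m.+1)^-1 * (between x y)%:R.
Proof.
rewrite /calderon_kernel prod_indicE; congr (_ * _); last first.
  congr (nat_of_bool _)%:R; apply: eq_forallb => j.
  by rewrite mem_setE in_itv.
rewrite -[x - _]opprB normrN; set u := tnth y ord_max - x.
have [u0|u0] := ltP 0 u.
  rewrite muln1 expr1 (gtr0_norm u0) (exprNn u) invfM mulrA; congr (_ * _).
  by rewrite exprS invfM mulrCA divff ?signr_eq0// mulr1 invrN1.
by rewrite muln0 expr0 (ler0_norm u0).
Qed.

Lemma normr_calderon_kernel x y : `|calderon_kernel x y| =
  (`|x - tnth y ord_max| ^+ m.+1)^-1 * (between x y)%:R.
Proof.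
rewrite calderon_kernelE !normrM normr_sign mul1r.
by rewrite ger0_norm ?invr_ge0 ?exprn_ge0// ger0_norm.
Qed.

(** Inversion is not continuous at 0; writing it as [t * (`|t| ^-1) ^+ 2] reduces it
    to a real power of a nonnegative number, for all [t] including 0. *)
Lemma measurable_inv d (T : measurableType d) (g : T -> R) :
  measurable_fun setT g -> measurable_fun setT (fun t => (g t)^-1).
Proof.
move=> mg; rewrite (_ : (fun _ => _) =
    fun t => g t * (((@powR R ^~ (-1)) \o Num.norm \o g) t) ^+ 2).
  apply: measurable_funM => //; apply: measurable_funX.
  apply: measurableT_comp => //.
  apply: measurableT_comp => //; exact: measurable_powR.
apply/funext => t /=; rewrite powR_inv1// -normfV -normrX ger0_norm ?sqr_ge0//.
have [->|g0] := eqVneq (g t) 0; first by rewrite invr0 mul0r.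
by rewrite expr2 mulrA divff// mul1r.
Qed.

Lemma measurable_calderon_kernel x :
  measurable_fun setT (calderon_kernel x : Rn -> R).
Proof.
have mt j : measurable_fun setT (fun y : Rn => tnth y j) by exact: measurable_tnth.
have mb : measurable_fun setT (fun y : Rn => 0 < tnth y ord_max - x).
  apply: measurable_fun_ltr => //; apply: measurable_funB => //; exact: mt.
apply: measurable_funM; last first.
  under eq_fun do rewrite big_mkcond.
  apply: measurable_prod => j _; case: (j != ord_max); last exact: measurable_cst.
  under eq_fun do rewrite indicE mem_setE in_itv.
  apply: measurable_natr_bool => //; apply: measurable_and;
      apply: measurable_fun_ltr; try exact: mt.
    by apply: measurable_minr => //; exact: mt.
  by apply: measurable_maxr => //; exact: mt.
apply: measurable_funM.
  rewrite (_ : (fun _ => _) =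
    fun y : Rn => if 0 < tnth y ord_max - x then (-1) ^+ m else 1).
    exact: measurable_fun_ifT.
  by apply/funext => y; case: ifP => _; rewrite ?muln1 ?muln0.
apply: measurable_inv; apply: measurable_funX.
by apply: measurable_funB => //; exact: mt.
Qed.

End kernel.

(** * Truncated integrals and multilinearity *)

Section truncation.
Variables (R : realType) (m : nat).
Local Notation Rm := (measurableTypeR R).
Local Notation mu := (@lebesgue_measure R).
Local Notation Rn := (m.+1.-tuple Rm).
Local Notation mun := (tuple_measure mu m.+1).
Local Notation normc := (@ComplexField.Normc.normc R).
Implicit Types (f : 'I_m.+1 -> R -> R[i]) (x e : R) (y : m.+1.-tuple R).

Definition trunc_kernel x e y : R :=
  (e < `|x - tnth y ord_max|)%R%:R * calderon_kernel x y.

Lemma bounded_trunc_kernel x e : 0 < e ->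
  bounded_kernel (trunc_kernel x e : Rn -> R).
Proof.
move=> e0; have mt j : measurable_fun setT (fun y : Rn => tnth y j).
  exact: measurable_tnth.
split.
  apply: measurable_funM; last exact: measurable_calderon_kernel.
  apply: measurable_natr_bool; apply: measurable_fun_ltr => //.
  apply: measurableT_comp => //.
  by apply: measurable_funB => //; exact: mt.
exists (e ^+ m.+1)^-1 => y; rewrite /trunc_kernel.
have [eu|_] := ltP e; last by rewrite mul0r normr0 invr_ge0 exprn_ge0// ltW.
rewrite mul1r normr_calderon_kernel.
apply: (@le_trans _ _ (`|x - tnth y ord_max| ^+ m.+1)^-1).
  by rewrite ler_piMr ?invr_ge0 ?exprn_ge0//; case: between.
have u0 := lt_trans e0 eu.
by rewrite lef_pV2 ?posrE ?exprn_gt0// lerXn2r ?nnegrE ?ltW.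
Qed.

Lemma calderon_truncE b f x e :
  coord b (calderon_trunc f x e) = pairing b f (trunc_kernel x e).
Proof.
transitivity (\int[mun]_(y in [set y | (e < `|x - tnth y ord_max|)%R])
    (calderon_kernel x y * coord b (tensor f y))).
  by case: b; apply: eq_Rintegral => y _;
    [rewrite -(coord_realM true)|rewrite -(coord_realM false)].
rewrite Rintegral_mkcond; apply: eq_Rintegral => y _.
rewrite /trunc_kernel patchE.
case: ifPn; rewrite ?notin_setE ?inE /=; first by move=> ->; rewrite mul1r.
by move/negP/negbTE => ->; rewrite !mul0r.
Qed.

Lemma tensor_restrictm (E : set R) f y :
  tensor (restrictm E f) y = (box (fun=> E) y)%:C * tensor f y.
Proof. by rewrite /tensor big_split/= real_complex_prod. Qed.

Lemma calderon_trunc_restrictE b (E : set R) f x e :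
  coord b (calderon_trunc (restrictm E f) x e) =
  pairing b f (trunc_kernel x e \* box (fun=> E)).
Proof.
rewrite calderon_truncE; apply: eq_Rintegral => y _.
by rewrite tensor_restrictm coord_realM mulrA.
Qed.

Lemma calderon_cvg f x b : mop_dom (calderon R m) f x ->
  coord b (calderon_trunc f x e) @[e --> 0^'+] --> coord b (calderon R m f x).
Proof. by move=> [dR dI]; case: b; [exact: dR|exact: dI]. Qed.

(** A complex coefficient mixes the two coordinates:
    the real part of [c h] involves the imaginary part of [h]. *)
Lemma pairingD_substm b f i (g h : R -> R[i]) (c : R[i]) k :
  (forall j, cintegrable (f j)) -> cintegrable g -> cintegrable h ->
  bounded_kernel k ->
  pairing b (substm f i (fun z => g z + c * h z)) k =
  pairing b (substm f i g) k +
  (complex.Re c * pairing b (substm f i h) k +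
   (if b then - complex.Im c else complex.Im c) * pairing (~~ b) (substm f i h) k).
Proof.
move=> If Ig Ih bk.
have Is (l : R -> R[i]) : cintegrable l -> forall j, cintegrable (substm f i l j).
  by move=> Il j; rewrite /substm; case: ifP.
have tensorE (l : R -> R[i]) y : tensor (substm f i l) y =
    l (tnth y i) * \prod_(j < m.+1 | j != i) f j (tnth y j).
  rewrite /tensor (bigD1 i)//= /substm eqxx; congr (_ * _).
  by apply: eq_bigr => j ji; rewrite (negbTE ji).
rewrite /pairing -!RintegralZl//; try by apply: integrable_pairing => //; exact: Is.
have Zl (r : R) b' : mun.-integrable setT
    (EFin \o (fun y => r * (k y * coord b' (tensor (substm f i h) y)))).
  have := integrableZl measurableT r (integrable_pairing b' (Is _ Ih) bk).
  by apply: eq_integrable.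
have ZZ : mun.-integrable setT (EFin \o (fun y =>
    complex.Re c * (k y * coord b (tensor (substm f i h) y)) +
    (if b then - complex.Im c else complex.Im c) *
      (k y * coord (~~ b) (tensor (substm f i h) y)))).
  have := integrableD measurableT (Zl (complex.Re c) b)
    (Zl (if b then - complex.Im c else complex.Im c) (~~ b)).
  by apply: eq_integrable.
rewrite -(RintegralD measurableT (Zl _ b) (Zl _ (~~ b))).
rewrite -(RintegralD measurableT (integrable_pairing b (Is _ Ig) bk) ZZ).
apply: eq_Rintegral => y _; rewrite !tensorE mulrDl -mulrA.
move: (g _ * _) (h _ * _) => u v.
clear ZZ; case: b; case: u v c => ? ? [? ?] [? ?] /=; ring.
Qed.

Lemma multilinear_calderon : multilinear (calderon R m).
Proof.
move=> f i g h c x If Ig Ih dg dh gh.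
pose s b : R := if b then - complex.Im c else complex.Im c.
have lim_gh b : coord b (calderon_trunc gh x e) @[e --> 0^'+] -->
    coord b (calderon R m (substm f i g) x) +
    (complex.Re c * coord b (calderon R m (substm f i h) x) +
     s b * coord (~~ b) (calderon R m (substm f i h) x)).
  have : coord b (calderon_trunc (substm f i g) x e) +
    (complex.Re c * coord b (calderon_trunc (substm f i h) x e) +
     s b * coord (~~ b) (calderon_trunc (substm f i h) x e)) @[e --> 0^'+] -->
    coord b (calderon R m (substm f i g) x) +
    (complex.Re c * coord b (calderon R m (substm f i h) x) +
     s b * coord (~~ b) (calderon R m (substm f i h) x)).
    by apply: cvgD; [|apply: cvgD; apply: cvgMr]; exact: calderon_cvg.
  apply: cvg_trans; apply: near_eq_cvg; near=> e.
  rewrite !calderon_truncE pairingD_substm//; apply: bounded_trunc_kernel.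
  by near: e; exact: nbhs_right_gt.
have dgh : mop_dom (calderon R m) gh x.
  split; apply/cvg_ex.
    by eexists; exact: (lim_gh true).
  by eexists; exact: (lim_gh false).
split=> //.
have E b : coord b (calderon R m gh x) = coord b (calderon R m (substm f i g) x) +
    (complex.Re c * coord b (calderon R m (substm f i h) x) +
     s b * coord (~~ b) (calderon R m (substm f i h) x)).
  exact: cvg_unique (calderon_cvg (b := b) dgh) (lim_gh b).
have := E false; have := E true; rewrite /s /coord.
move: (calderon R m gh x) (calderon R m _ x) (calderon R m _ x).
case=> a1 a2 [b1 b2] [c1 c2]; case: (c) => r1 r2 /= -> ->.
by rewrite mulNr.
Unshelve. all: by end_near.
Qed.

End truncation.

(** * Intervals given by centre and radius *)

Section centered_intervals.
Variable R : realType.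
Local Notation Rm := (measurableTypeR R).
Local Notation mu := (@lebesgue_measure R).
Local Notation normc := (@ComplexField.Normc.normc R).
Implicit Types (s t : bool) (c r z : R).

(** Dilating a concentric interval keeps the kind of its endpoints, so the four
    kinds are carried along by [s] and [t]. *)
Definition ival s t c r : set R :=
  [set` Interval (BSide s (c - r)) (BSide t (c + r))].

Lemma intervals_ival s t c r : 0 < r -> intervals R (ival s t c r).
Proof. by move=> r0; exists (c - r), (c + r), s, t; split=> //; lra. Qed.

Lemma intervalsP (Q : set R) : intervals R Q ->
  exists s t c r, 0 < r /\ Q = ival s t c r.
Proof.
move=> [a [b [s [t [ab ->]]]]].
exists s, t, ((a + b) / 2), ((b - a) / 2); split; first lra.
rewrite /ival (_ : (a + b) / 2 - (b - a) / 2 = a); last lra.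
by rewrite (_ : (a + b) / 2 + (b - a) / 2 = b); last lra.
Qed.

Lemma ival_dist s t c r z : ival s t c r z -> `|z - c| <= r.
Proof.
rewrite /ival /= in_itv /= ler_norml.
by case: s; case: t => /= /andP[? ?]; lra.
Qed.

Lemma dist_ival s t c r z : `|z - c| < r -> ival s t c r z.
Proof.
rewrite /ival /= in_itv /= ltr_norml.
by case: s; case: t => /= /andP[? ?]; lra.
Qed.

Lemma notin_ival s t c r z : ~ ival s t c r z -> r <= `|z - c|.
Proof. by move=> zI; rewrite leNgt; apply/negP => /(dist_ival s t). Qed.

Lemma ival_subset s t c r r' : r < r' -> ival s t c r `<=` ival s t c r'.
Proof. by move=> rr' z /ival_dist zr; apply: dist_ival; lra. Qed.

Lemma ival_convex s t c r z1 z2 z : ival s t c r z1 -> ival s t c r z2 ->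
  z1 <= z <= z2 -> ival s t c r z.
Proof.
rewrite /ival /= !in_itv /=.
by case: s; case: t => /= /andP[? ?] /andP[? ?] /andP[? ?]; lra.
Qed.

Lemma measurable_ival s t c r : measurable (ival s t c r : set Rm).
Proof. exact: measurable_itv. Qed.

Lemma lebesgue_measure_ival s t c r : 0 < r -> mu (ival s t c r) = (2 * r)%:E.
Proof.
move=> r0; rewrite /ival lebesgue_measure_itv /= lte_fin.
by rewrite ifT; [rewrite -EFinB; congr (_%:E)|]; lra.
Qed.

Lemma star_ival s t c r : 0 < r -> star (ival s t c r) = ival s t c (18 * r).
Proof.
move=> r0; have cr : c - r < c + r by lra.
have supE : sup (ival s t c r) = c + r.
  by rewrite sup_itv//; case: (s); case: (t); rewrite bnd_simp// ltW.
have infE : inf (ival s t c r) = c - r.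
  by rewrite inf_itv//; case: (s); case: (t); rewrite bnd_simp// ltW.
rewrite /star /dilation supE infE (_ : (c - r + (c + r)) / 2 = c); last lra.
clear supE infE; apply/seteqP; split => [_ [z + <-]|z].
  rewrite /ival /= !in_itv /=.
  by case: s; case: t => /= /andP[? ?]; lra.
rewrite /ival /= !in_itv /= => zI; exists (c + (z - c) / 18); last lra.
rewrite /= in_itv /=; move: zI.
by case: s; case: t => /= /andP[? ?]; lra.
Qed.

Lemma integral_ival (f : R -> R[i]) s t c r : 0 < r ->
  \int[mu]_(y in ival s t c r) normc (f y) =
  2 * r * average f (ival s t c r).
Proof.
move=> r0; rewrite /average lebesgue_measure_ival//= mulrA divff ?mul1r//.
by rewrite mulf_neq0// gt_eqF.
Qed.

Lemma average_ge0 (f : R -> R[i]) (Q : set R) : 0 <= average f Q.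
Proof.
rewrite mulr_ge0 ?invr_ge0 ?fine_ge0//.
by apply: integral_ge0 => x _; rewrite lee_fin normc_ge0.
Qed.

(** The supremum is one of real numbers, so it bounds its members only because
    the averages over the intervals containing a fixed one are bounded: by the
    full integral divided by its length. *)
Lemma average_le_sup (f : R -> R[i]) s t c r Q' : 0 < r -> cintegrable f ->
  intervals R Q' -> ival s t c r `<=` Q' ->
  average f Q' <= sup_average (intervals R) f (ival s t c r).
Proof.
move=> r0 If IQ' QQ'; apply: ub_le_sup; last by exists Q'.
exists ((2 * r)^-1 * \int[mu]_y normc (f y)) => _ [Q [+ QQ] <-].
move=> /intervalsP [s' [t' [c' [r' [r'0 QE]]]]].
move: QQ; rewrite {}QE => QQ.
rewrite /average lebesgue_measure_ival//=.
have rr' : 2 * r <= 2 * r'.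
  rewrite -lee_fin -(lebesgue_measure_ival s t c)// -(lebesgue_measure_ival s' t' c')//.
  by apply: le_measure => //; rewrite inE; exact: measurable_ival.
have iN := integrable_normc If.
apply: ler_pM.
- by rewrite invr_ge0; lra.
- by apply: Rintegral_ge0 => x _; exact: normc_ge0.
- by rewrite lef_pV2// posrE; lra.
- have mQ' := measurable_ival s' t' c' r'.
  rewrite /Rintegral fine_le//.
  + by apply: integrable_fin_num => //; exact: integrableS iN.
  + exact: integrable_fin_num.
  + apply: ge0_subset_integral => //; first exact: measurable_int iN.
    by move=> x _; rewrite lee_fin normc_ge0.
Qed.

End centered_intervals.

(** * Effect of cutting to a dilated interval on the kernel *)

Section pointwise.
Variables (R : realType) (m : nat).
Implicit Types (x e c r : R) (y : m.+1.-tuple R) (s t : bool).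

Lemma between_ord x y (j : 'I_m.+1) : between x y -> j != ord_max ->
  Num.min x (tnth y ord_max) < tnth y j < Num.max x (tnth y ord_max).
Proof. by move=> /forallP/(_ j)/implyP; exact. Qed.

(** The localization of the kernel: its support stays in any interval that contains
    both [x] and the last variable. *)
Lemma between_ival s t c r x y : between x y -> ival s t c r x ->
  ival s t c r (tnth y ord_max) -> forall j, ival s t c r (tnth y j).
Proof.
move=> xy Ix Iy j; have [->//|jm] := eqVneq j ord_max.
have := between_ord xy jm; rewrite gt_min lt_max.
have [xym|ymx] := leP x (tnth y ord_max).
  by move=> h; apply: (ival_convex Ix Iy); lra.
by move=> h; apply: (ival_convex Iy Ix); lra.
Qed.

Lemma box_cst1 (E : set R) y : (forall j, E (tnth y j)) -> box (fun=> E) y = 1.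
Proof.
move=> Ey; rewrite boxE (_ : [forall i, _])//; apply/forallP => i.
exact/mem_set/Ey.
Qed.

Lemma box_cst0 (E : set R) y j : ~ E (tnth y j) -> box (fun=> E) y = 0.
Proof.
move=> Ey; rewrite boxE (_ : [forall i, _] = false)//; apply/negbTE/forallPn.
by exists j; rewrite notin_setE.
Qed.

(** If the last variable is in the small interval, so are all the others and the two
    cut-offs agree; otherwise it is at distance at least [18 r - r] from [x]. *)
Lemma trunc_kernel_ring s t c r x e y : 0 < r -> ival s t c r x ->
  `|(trunc_kernel x e y * box (fun=> ival s t c (36 * r)) y) -
    (trunc_kernel x e y * box (fun=> ival s t c (18 * r)) y)| <=
  ((9 * r) ^+ m.+1)^-1 * box (fun=> ival s t c (36 * r)) y.
Proof.
move=> r0 xI; set S1 := ival s t c (36 * r); set S0 := ival s t c (18 * r).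
have S01 : S0 `<=` S1 by apply: ival_subset; lra.
have rhs0 : 0 <= ((9 * r) ^+ m.+1)^-1 * box (fun=> S1) y.
  by rewrite mulr_ge0 ?box_ge0// invr_ge0 exprn_ge0//; lra.
have [xy|/negbTE xy] := boolP (between x y); last first.
  by rewrite /trunc_kernel calderon_kernelE xy !mulr0 !mul0r subrr normr0.
have xS0 : S0 x by apply: ival_subset xI; lra.
have [yS0|yS0] := pselect (S0 (tnth y ord_max)).
  have yj := between_ival xy xS0 yS0.
  have yj1 j : S1 (tnth y j) by exact/S01/yj.
  rewrite (box_cst1 yj) (box_cst1 yj1) subrr normr0 mulr1 invr_ge0.
  by rewrite exprn_ge0//; lra.
rewrite (box_cst0 yS0) mulr0 subr0 normrM (ger0_norm (box_ge0 _ _)).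
apply: ler_wpM2r; first exact: box_ge0.
rewrite /trunc_kernel normrM normr_calderon_kernel.
have u9 : 9 * r <= `|x - tnth y ord_max|.
  have := notin_ival yS0; have := ival_dist xI.
  have := ler_normD (tnth y ord_max - x) (x - c).
  by rewrite subrKA distrC => ? ? ?; rewrite distrC; lra.
apply: (@le_trans _ _ (`|x - tnth y ord_max| ^+ m.+1)^-1).
  rewrite mulrCA ler_piMr ?invr_ge0 ?exprn_ge0//.
  by case: (_ < _); case: between; rewrite ?normr1 ?normr0 ?mul1r ?mul0r.
by rewrite lef_pV2 ?posrE ?exprn_gt0 ?lerXn2r ?nnegrE//; lra.
Qed.

(** The right-hand side does not involve [e]: after subtraction of the local
    part, the principal value is an absolutely convergent integral. *)
Lemma trunc_kernel_far s t c r x e y : 0 < r -> e < 16 * r -> ival s t c r x ->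
  trunc_kernel x e y - trunc_kernel x e y * box (fun=> ival s t c (18 * r)) y =
  (tnth y ord_max \notin ival s t c (18 * r))%:R * calderon_kernel x y.
Proof.
move=> r0 er xI; set S := ival s t c (18 * r).
have [xy|/negbTE xy] := boolP (between x y); last first.
  by rewrite /trunc_kernel calderon_kernelE xy !mulr0 !mul0r subrr.
have xS : S x by apply: ival_subset xI; lra.
have [yS|yS] := boolP (tnth y ord_max \in S).
  rewrite box_cst1 ?mulr1 ?subrr ?mul0r//.
  by apply: between_ival xy xS _; exact: set_mem.
have yS' : ~ S (tnth y ord_max) by move/mem_set; exact/negP.
rewrite (box_cst0 yS') mulr0 subr0 mul1r /trunc_kernel.
suff -> : (e < `|x - tnth y ord_max|)%R by rewrite mul1r.
have := notin_ival yS'; have := ival_dist xI.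
have := ler_normD (tnth y ord_max - x) (x - c).
by rewrite subrKA distrC => ? ? ?; rewrite distrC; lra.
Qed.

Lemma subrX_le (a b rho : R) n : 0 <= a <= rho -> 0 <= b <= rho ->
  `|a ^+ n.+1 - b ^+ n.+1| <= `|a - b| * (n.+1%:R * rho ^+ n).
Proof.
move=> /andP[a0 ar] /andP[b0 br]; rewrite subrXX normrM ler_wpM2l//.
apply: le_trans (ler_norm_sum _ _ _) _.
rewrite -[n.+1 in leRHS]card_ord mulr_natl -sumr_const; apply: ler_sum => i _.
have i_n : (i <= n)%N by rewrite -ltnS.
rewrite normrM !normrX !ger0_norm//= -[X in _ <= rho ^+ X](subnK i_n) exprD.
by apply: ler_pM; rewrite ?exprn_ge0// lerXn2r// nnegrE (le_trans a0).
Qed.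

End pointwise.

(** * Oscillation of the kernel on dyadic shells *)

Section kernel_difference.
Variables (R : realType) (m : nat) (s t : bool) (c r : R).
Implicit Types (x : R) (y : m.+1.-tuple R) (l : nat) (i j : 'I_m.+1).

(** The factor 8 makes the shells start at [16 * r], below the radius [18 * r]
    of the dilated interval, and leaves [2 * radius l - r >= radius l]. *)
Definition radius l : R := 8 * 2 ^+ l * r.

(** For [j = ord_max] the box is the cube of the ball of radius [4 * radius l] and
    [box_coef] comes from the derivative of the power; for the other [j] the [j]-th
    side shrinks to the small interval and [box_coef] is the size of the kernel. *)
Definition box_side l j i : set R :=
  if (j != ord_max) && (i == j) then ival s t c r else ival s t c (4 * radius l).

Definition box_coef l j : R :=
  if j == ord_max then 2 * r * (m.+1%:R * (radius l)^-1 ^+ m.+2)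
  else (radius l)^-1 ^+ m.+1.

Lemma radius_ge l : 0 < r -> 8 * r <= radius l.
Proof. by move=> r0; rewrite /radius ler_pM2r// ler_peMr// exprn_ege1// ler1n. Qed.

Lemma radius_gt0 l : 0 < r -> 0 < radius l.
Proof. by move=> r0; have := radius_ge l r0; lra. Qed.

Lemma box_coef_ge0 l j : 0 < r -> 0 <= box_coef l j.
Proof.
move=> r0; have := ltW (radius_gt0 l r0); have := ltW r0 => r0' l0.
rewrite /box_coef; case: ifP => _; last by rewrite exprn_ge0// invr_ge0.
apply: mulr_ge0; first exact: mulr_ge0.
apply: mulr_ge0 => //; apply: exprn_ge0; by rewrite invr_ge0.
Qed.

(** Take the least [l] such that the upper bound holds. *)
Lemma radius_shell (w : R) : 0 < r -> 16 * r <= w ->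
  exists l, 2 * radius l <= w < 4 * radius l.
Proof.
move=> r0 wr; have ex : exists l, w < 4 * radius l.
  have w0 : 0 <= w / r by rewrite divr_ge0//; lra.
  exists (Num.bound (w / r)); have := archi_boundP w0.
  rewrite ltr_pdivrMr// => /lt_le_trans; apply.
  rewrite /radius mulrA mulrA ler_pM2r//.
  apply: (@le_trans _ _ (2 ^+ Num.bound (w / r))).
    by rewrite -natrX ler_nat ltnW// ltn_expl.
  by rewrite ler_peMl ?exprn_ge0//; lra.
case: (ex_minnP ex) => -[|l] wl lmin.
  by exists 0%N; rewrite wl andbT /radius expr0; lra.
exists l.+1; rewrite wl andbT leNgt; apply/negP => wl'.
suff /lmin : w < 4 * radius l by rewrite ltnn.
by move: wl'; rewrite /radius exprS; lra.
Qed.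

Lemma shell_dist l x y : 0 < r -> ival s t c r x ->
  2 * radius l <= `|tnth y ord_max - c| -> radius l <= `|x - tnth y ord_max|.
Proof.
move=> r0 /ival_dist xc yc; have := radius_ge l r0.
have := ler_normD (tnth y ord_max - x) (x - c).
by rewrite subrKA => ? ?; rewrite distrC; lra.
Qed.

Lemma le_box_sum l j y : 0 < r -> box (box_side l j) y = 1 ->
  box_coef l j <= \sum_(j < m.+1) box_coef l j * box (box_side l j) y.
Proof.
move=> r0 yj; rewrite (bigD1 j)//= yj mulr1 lerDl sumr_ge0// => i _.
by rewrite mulr_ge0 ?box_ge0 ?box_coef_ge0.
Qed.

Lemma between_ball l x y : 0 < r -> between x y -> ival s t c r x ->
  `|tnth y ord_max - c| < 4 * radius l ->
  forall i, ival s t c (4 * radius l) (tnth y i).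
Proof.
move=> r0 xy xI yl; apply: (between_ival xy); last exact: dist_ival.
by apply: ival_subset xI; have := radius_ge l r0; lra.
Qed.

(** Some variable lies between [x] and the last variable but not between [x'] and the
    last variable.  As the last variable is far away, on the same side of both points,
    that variable is caught between [x] and [x'], hence in the small interval. *)
Lemma one_sided l x x' y : 0 < r -> ival s t c r x -> ival s t c r x' ->
  2 * radius l <= `|tnth y ord_max - c| < 4 * radius l ->
  between x y -> ~~ between x' y ->
  `|calderon_kernel x y| <=
    \sum_(j < m.+1) box_coef l j * box (box_side l j) y.
Proof.
move=> r0 xI x'I /andP[yl1 yl2] xy /forallPn[j].
rewrite negb_imply => /andP[jm x'y].
have yjI : ival s t c r (tnth y j).
  have := between_ord xy jm; move: x'y.
  have := ival_dist xI; have := ival_dist x'I; have := radius_ge l r0.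
  move: yl1; rewrite !ler_norml negb_and -!leNgt !le_min !ge_max gt_min lt_max.
  set w := tnth y ord_max; set z := tnth y j.
  rewrite ler_normr => /orP yl1 lr /andP[x'1 x'2] /andP[x1 x2].
  move=> /orP yx' /andP[/orP yx1 /orP yx2].
  have [xx'|x'x] := leP x x'.
    by apply: (ival_convex xI x'I); case: yl1; case: yx'; case: yx1; case: yx2; lra.
  by apply: (ival_convex x'I xI); case: yl1; case: yx'; case: yx1; case: yx2; lra.
apply: le_trans (le_box_sum (l := l) (j := j) r0 _).
  rewrite normr_calderon_kernel xy mulr1 /box_coef (negbTE jm) exprVn.
  have u := shell_dist r0 xI yl1; have l0 := radius_gt0 l r0.
  have u0 := lt_le_trans l0 u.
  by rewrite lef_pV2 ?posrE ?exprn_gt0// lerXn2r ?nnegrE// ltW.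
rewrite boxE (_ : [forall i, _])//; apply/forallP => i; apply/mem_set.
rewrite /box_side jm /=; case: eqP => [->//|_].
exact: (between_ball r0 xy xI yl2).
Qed.

Lemma calderon_kernel_diff l x x' y : 0 < r -> ival s t c r x -> ival s t c r x' ->
  2 * radius l <= `|tnth y ord_max - c| < 4 * radius l ->
  `|calderon_kernel x y - calderon_kernel x' y| <=
    \sum_(j < m.+1) box_coef l j * box (box_side l j) y.
Proof.
move=> r0 xI x'I yl.
have [xy|/[dup] nxy /negbTE xy] := boolP (between x y);
    have [x'y|/[dup] nx'y /negbTE x'y] := boolP (between x' y); first last.
- rewrite !calderon_kernelE xy x'y !mulr0 subrr normr0.
  by rewrite sumr_ge0// => j _; rewrite mulr_ge0 ?box_ge0 ?box_coef_ge0.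
- rewrite (calderon_kernelE x) xy mulr0 sub0r normrN.
  exact: one_sided r0 x'I xI yl x'y nxy.
- rewrite (calderon_kernelE x') x'y mulr0 subr0.
  exact: one_sided r0 xI x'I yl xy nx'y.
have /andP[yl1 yl2] := yl.
apply: le_trans (le_box_sum (l := l) (j := ord_max) r0 _); last first.
  rewrite boxE (_ : [forall i, _])//; apply/forallP => i; apply/mem_set.
  by rewrite /box_side eqxx; exact: (between_ball r0 xy xI yl2).
have u := shell_dist r0 xI yl1; have u' := shell_dist r0 x'I yl1.
have lr := radius_ge l r0.
have sgn : (0 < tnth y ord_max - x) = (0 < tnth y ord_max - x').
  have := ival_dist xI; have := ival_dist x'I; move: yl1.
  rewrite !ler_norml ler_normr => /orP yl1' /andP[x'1 x'2] /andP[x1 x2].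
  by apply/idP/idP => ?; case: yl1'; lra.
rewrite !calderon_kernelE xy x'y !mulr1 sgn -mulrBr normrM normr_sign mul1r.
rewrite /box_coef eqxx -!exprVn.
have l0 := radius_gt0 l r0; have u0 := lt_le_trans l0 u.
have u'0 := lt_le_trans l0 u'.
apply: le_trans (subrX_le (rho := (radius l)^-1) m _ _) _.
- by rewrite invr_ge0 normr_ge0 lef_pV2.
- by rewrite invr_ge0 normr_ge0 lef_pV2.
have -> : 2 * r * (m.+1%:R * (radius l)^-1 ^+ m.+2) =
    2 * r * (radius l)^-1 ^+ 2 * (m.+1%:R * (radius l)^-1 ^+ m).
  by rewrite -(addn2 m) exprD; ring.
rewrite ler_wpM2r ?mulr_ge0 ?exprn_ge0 ?invr_ge0 ?(ltW l0)//.
have -> : `|x - tnth y ord_max|^-1 - `|x' - tnth y ord_max|^-1 =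
    (`|x' - tnth y ord_max| - `|x - tnth y ord_max|) *
    (`|x - tnth y ord_max|^-1 * `|x' - tnth y ord_max|^-1).
  by field; rewrite !gt_eqF.
rewrite normrM; apply: ler_pM => //.
  apply: le_trans (ler_dist_dist _ _) _.
  rewrite (_ : _ - _ = (x' - c) - (x - c)); last ring.
  apply: le_trans (ler_normB _ _) _.
  by have := ival_dist xI; have := ival_dist x'I; lra.
rewrite ger0_norm ?mulr_ge0 ?invr_ge0// expr2.
by apply: ler_pM; rewrite ?invr_ge0// lef_pV2.
Qed.

End kernel_difference.

(** * The two oscillation bounds *)

Section bounded_oscillation.
Variables (R : realType) (m : nat).
Local Notation Rm := (measurableTypeR R).
Local Notation mu := (@lebesgue_measure R).
Local Notation Rn := (m.+1.-tuple Rm).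
Local Notation normc := (@ComplexField.Normc.normc R).
Implicit Types (f : 'I_m.+1 -> R -> R[i]) (x e : R).

Lemma cvg_coordB b (u v : R -> R) (z w : R[i]) :
  u e @[e --> 0^'+] --> coord b z -> v e @[e --> 0^'+] --> coord b w ->
  u e - v e @[e --> 0^'+] --> coord b (z - w).
Proof. by move=> uz vw; rewrite coordB; exact: cvgB. Qed.

(** The factor 2 is the price of bounding the real and the imaginary part
    separately. *)
Lemma normc_lim_dist_le (u v : bool -> R -> R) (z w : R[i]) (M : R) :
  (forall b, u b e @[e --> 0^'+] --> coord b z) ->
  (forall b, v b e @[e --> 0^'+] --> coord b w) ->
  (forall b, \forall e \near 0^'+, `|u b e - v b e| <= M) ->
  normc (z - w) <= 2 * M.
Proof.
move=> uz vw uv; apply: le_trans (normc_le_coord _) _.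
have lim b : `|coord b (z - w)| <= M.
  apply: cvgr_to_le (uv b).
  by apply: cvg_norm; exact: cvg_coordB.
by have := lim true; have := lim false; lra.
Qed.

(** The constant is [72 r / (9 r) = 8] to the power [m.+1], twice for the two
    coordinates. *)
Lemma calderon_T1 :
  bounded_oscillation_T1 (intervals R) (calderon R m) (2 * 8 ^+ m.+1).
Proof.
move=> _ /intervalsP[s [t [c [r [r0 ->]]]]].
exists (ival s t c (2 * r)); split; first by apply: intervals_ival; lra.
  split; first by apply: ival_subset; lra.
  have zI : ival s t c (2 * r) (c + 3 / 2 * r).
    by apply: dist_ival; rewrite addrAC subrr add0r ger0_norm; lra.
  move=> /(_ _ zI) /ival_dist.
  by rewrite addrAC subrr add0r ger0_norm; lra.
move=> f If x xI; rewrite !star_ival//; last lra.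
rewrite (_ : 18 * (2 * r) = 36 * r); last ring.
set S1 := ival s t c (36 * r); set S0 := ival s t c (18 * r) => d1 d0.
rewrite -mulrA.
apply: normc_lim_dist_le => [b|b|b]; [exact: calderon_cvg d1|exact: calderon_cvg d0|].
have mS1 : measurable (S1 : set Rm) := measurable_ival s t c (36 * r).
have mS0 : measurable (S0 : set Rm) := measurable_ival s t c (18 * r).
near=> e; have e0 : 0 < e by near: e; exact: nbhs_right_gt.
have bS (E : set Rm) : measurable E ->
    bounded_kernel (trunc_kernel x e \* box (fun=> E) : Rn -> R).
  move=> mE; apply: bounded_kernelM; first exact: bounded_trunc_kernel.
  exact: bounded_kernel_box.
rewrite !calderon_trunc_restrictE pairingB; [|exact: If|exact: bS|exact: bS].
apply: le_trans (pairing_le_box (A := fun=> S1)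
  (c := ((9 * r) ^+ m.+1)^-1) _ _ _ _ _ _) _ => //.
- by apply: bounded_kernelB; exact: bS.
- by rewrite invr_ge0 exprn_ge0//; lra.
- by move=> y; exact: trunc_kernel_ring.
have r36 : 0 < 36 * r by lra.
rewrite (eq_bigr (fun i => 2 * (36 * r) * average (f i) S1)); last first.
  by move=> i _; exact: integral_ival.
rewrite big_split/= prodr_const card_ord [leLHS]mulrA ler_wpM2r//.
  by apply: prodr_ge0 => i _; exact: average_ge0.
rewrite mulrC -expr_div_n (_ : 2 * (36 * r) / (9 * r) = 8)//.
by field; lra.
Unshelve. all: by end_near.
Qed.

(** On the [l]-th shell each of the [m.+1] boxes contributes at most
    [m.+1%:R * 8 ^+ m.+1] times [2 * r / radius l = 2^-1 / 2 ^+ l.+1] times the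
    product of the suprema. *)
Lemma calderon_T2 :
  bounded_oscillation_T2 (intervals R) (calderon R m)
    (m.+1%:R ^+ 2 * 8 ^+ m.+1).
Proof.
move=> _ /intervalsP[s [t [c [r [r0 ->]]]]] f If x x' xI x'I.
rewrite !star_ival//.
set S := ival s t c (18 * r) => d1 d2 d1' d2'.
set I := ival s t c r.
pose M := \prod_i sup_average (intervals R) (f i) I.
rewrite -/M (_ : m.+1%:R ^+ 2 * 8 ^+ m.+1 * M =
  2 * (m.+1%:R ^+ 2 * 8 ^+ m.+1 / 2 * M)); last by field.
apply: (normc_lim_dist_le
  (u := fun b e => coord b (calderon_trunc f x e) -
                   coord b (calderon_trunc (restrictm S f) x e))
  (v := fun b e => coord b (calderon_trunc f x' e) -
                   coord b (calderon_trunc (restrictm S f) x' e)))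
  => b.
- exact: cvg_coordB (calderon_cvg d1) (calderon_cvg d2).
- exact: cvg_coordB (calderon_cvg d1') (calderon_cvg d2').
near=> e; have e0 : 0 < e by near: e; exact: nbhs_right_gt.
have er : e < 16 * r by near: e; apply: nbhs_right_lt; lra.
have mS : measurable (S : set Rm) := measurable_ival s t c (18 * r).
have bT z : bounded_kernel (trunc_kernel z e : Rn -> R).
  exact: bounded_trunc_kernel.
have bS z : bounded_kernel (trunc_kernel z e \* box (fun=> S) : Rn -> R).
  by apply: bounded_kernelM => //; exact: bounded_kernel_box.
have bD z : bounded_kernel
    (trunc_kernel z e \- (trunc_kernel z e \* box (fun=> S)) : Rn -> R).
  exact: bounded_kernelB.
rewrite (calderon_truncE b f x) (calderon_truncE b f x').
rewrite !calderon_trunc_restrictE !pairingB//.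
apply: (@pairing_le_boxes R m.+1 b f _ _ (box_side s t c r) (@box_coef R m r)) => //.
- move=> l j i; rewrite /box_side; case: ifP => _; exact: measurable_ival.
- exact: bounded_kernelB.
- by move=> l j; exact: box_coef_ge0.
- move=> y; rewrite /= !trunc_kernel_far// -mulrBr mulf_eq0 negb_or.
  case: (boolP (_ \notin _)) => [yS _|]; last by rewrite eqxx.
  have [|l yl] := radius_shell (w := `|tnth y ord_max - c|) r0.
    by move: yS; rewrite notin_setE => /notin_ival; lra.
  by exists l; rewrite mul1r; exact: calderon_kernel_diff.
move=> l; have l0 := radius_gt0 l r0.
have M0 : 0 <= M.
  apply: prodr_ge0 => i _; apply: le_trans (average_ge0 (f i) I) _.
  by apply: average_le_sup => //; exact: intervals_ival.
have sideM r' i : r <= r' -> 0 < r' -> I `<=` ival s t c r' ->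
    \int[mu]_(z in ival s t c r') normc (f i z) <=
    2 * r' * sup_average (intervals R) (f i) I.
  move=> rr' r'0 II'; rewrite integral_ival// ler_pM2l; last by lra.
  by apply: average_le_sup => //; exact: intervals_ival.
have IB : I `<=` ival s t c (4 * radius r l).
  by apply: ival_subset; have := radius_ge l r0; lra.
pose len (j i : 'I_m.+1) : R :=
  if (j != ord_max) && (i == j) then 2 * r else 8 * radius r l.
have prodM j : \prod_(i < m.+1) \int[mu]_(z in box_side s t c r l j i) normc (f i z) <=
    (\prod_(i < m.+1) len j i) * M.
  rewrite /M -big_split/=; apply: ler_prod => i _; apply/andP; split.
    by apply: Rintegral_ge0 => z _; exact: normc_ge0.
  rewrite /box_side /len; case: ifP => _; first exact: sideM.
  rewrite (_ : 8 * _ = 2 * (4 * radius r l)); last ring.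
  by apply: sideM => //; have := radius_ge l r0; lra.
have ratio : 2 * r * (radius r l)^-1 = 2^-1 / 2 ^+ l.+1.
  rewrite /radius exprS; field.
  by rewrite expf_neq0//= gt_eqF.
have term j : box_coef r l j * \prod_(i < m.+1) len j i <=
    m.+1%:R * 8 ^+ m.+1 * (2 * r * (radius r l)^-1).
  rewrite /box_coef /len; have [->|jm] := eqVneq j ord_max.
    rewrite /= prodr_const card_ord exprMn exprS le_eqVlt; apply/orP; left.
    apply/eqP; rewrite exprVn.
    by field; rewrite ?expf_neq0 ?gt_eqF.
  rewrite (bigD1 j)//= eqxx (eq_bigr (fun=> 8 * radius r l)); last first.
    by move=> i /negbTE ->.
  rewrite prodr_const cardC1 card_ord /= exprMn exprS.
  rewrite (_ : _ * _ = 8 ^+ m * (2 * r * (radius r l)^-1)); last first.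
    by rewrite exprVn; field; rewrite ?expf_neq0 ?gt_eqF.
  apply: ler_wpM2r; first by rewrite !mulr_ge0 ?invr_ge0 ?ltW.
  rewrite exprS mulrA ler_peMl ?exprn_ge0//.
  by rewrite -natrM ler1n.
apply: (@le_trans _ _ (\sum_(j < m.+1)
    m.+1%:R * 8 ^+ m.+1 * (2 * r * (radius r l)^-1) * M)).
  apply: ler_sum => j _; apply: le_trans (ler_wpM2l (box_coef_ge0 l j r0) (prodM j)) _.
  by rewrite [leLHS]mulrA ler_wpM2r.
rewrite sumr_const card_ord ratio natrX -[leLHS]mulr_natl.
rewrite le_eqVlt; apply/orP; left; apply/eqP.
by field; rewrite expf_neq0.
Unshelve. all: by end_near.
Qed.

End bounded_oscillation.

Theorem theorem2p24 (R : realType) (m : nat) :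
  bounded_oscillation (intervals R) (calderon R m).
Proof.
split; first exact: multilinear_calderon.
exists (2 * 8 ^+ m.+1), (m.+1%:R ^+ 2 * 8 ^+ m.+1); split.
- by rewrite mulr_gt0 ?exprn_gt0.
- by rewrite mulr_gt0 ?exprn_gt0.
- exact: calderon_T1.
- exact: calderon_T2.
Qed.
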